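(* Let $k\ge0$ be an integer, let $F\in\mathcal F_k(G)$, and let $\mathscr B^F$ be a $\mathbb Z$-basis of $B^1(G,F)$. In $\big(\bigwedge^kC^1(G)\big)^{\otimes2}$, one has $$(\det\mathscr B^F)^{\otimes2}=\sum_{T\in\mathcal T(G),\,T\supseteq F}(\mathsf B_T)^{\wedge k}(e^\star_{T\setminus F})\otimes e^\star_{T\setminus F}.$$
   Context: $G=(V,E)$ is a finite connected graph: $V$ is a finite set of vertices and $E$ a finite set of oriented edges, with source and target maps $s,t:E\to V$ and a fixed-point-free involution $e\mapsto e^{-1}$ of $E$ exchanging source and target. $E^+\subset E$ is a fixed subset containing exactly one element of each pair $\{e,e^{-1}\}$, with a fixed total order. A subgraph is a subset $S\subseteq E$ stable under $e\mapsto e^{-1}$, seen as the graph $(V,S)$; $S^c=E\setminus S$. $\mathcal T(G)$ is the set of spanning trees; $\mathcal F_k(G)$ is the set of acyclic (spanning) subgraphs with $k+1$ connected components. $C_1(G)$ is the free abelian group on $E$ modulo $e+e^{-1}=0$; $C^1(G)=\mathrm{Hom}(C_1(G),\mathbb Z)$, with basis $(e^\star)_{e\in E^+}$ dual to $E^+$; $C^1(S)$ is the subgroup generated by $\{e^\star:e\in S\}$. $\delta$ sends $f:V\to\mathbb Z$ to $\delta f\in C^1(G)$, $\delta f(e)=f(t(e))-f(s(e))$; $B^1(G)=\operatorname{im}\delta$; $B^1(G,F)=B^1(G)\cap C^1(F^c)$ is the group of coboundaries vanishing on $F$. For a spanning tree $T$ one has $C^1(G)=B^1(G)\oplus C^1(T^c)$,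 and $\mathsf B_T:C^1(G)\to B^1(G)$ is the corresponding projection; $(\mathsf B_T)^{\wedge k}$ is the induced map on $\bigwedge^kC^1(G)$. For a $\mathbb Z$-basis $\mathscr B^F=(\beta_1,\dots,\beta_k)$, $\det\mathscr B^F=\beta_1\wedge\dots\wedge\beta_k$. For $S\subseteq E$ with $S\cap E^+=\{e_1<\dots<e_r\}$, $e^\star_S=e_1^\star\wedge\dots\wedge e_r^\star$. The tensor square is over $\mathbb Z$, and $u^{\otimes 2}=u\otimes u$. *)

(* Defs.v *)
From HB Require Import structures.
From mathcomp Require Import all_boot all_order all_algebra.
From mathcomp Require Import generic_quotient ring_quotient.
From mathcomp Require Import boolp classical_sets functions.
From mathcomp Require Import freeg.

Set Implicit Arguments.
Unset Strict Implicit.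
Unset Printing Implicit Defensive.

Import GRing.Theory.

Local Open Scope ring_scope.
Local Open Scope quotient_scope.

Section Span.
Variable M : zmodType.

Inductive span (A : set M) : set M :=
| span_gen x of A x : span A x
| span_0 : span A 0
| span_B x y of span A x & span A y : span A (x - y).

Definition spanb (A : set M) : {pred M} := fun x => `[< span A x >].

Lemma spanb_zmod_closed A : zmod_closed (spanb A).
Proof.
split=> [|x y /asboolP Ax /asboolP Ay]; apply/asboolP; first exact: span_0.
exact: span_B.
Qed.

HB.instance Definition _ A :=
  GRing.isZmodClosed.Build M (spanb A) (spanb_zmod_closed A).

Definition quot_span (A : set M) : zmodType := Quotient.quot (spanb A).

Definition quot_pi (A : set M) (x : M) : quot_span A := \pi_(quot_span A) x.

Lemma quot_pi_zmod_morphism A : zmod_morphism (quot_pi A).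
Proof. exact: (@pi_is_zmod_morphism _ _ _ (Quotient.quot (spanb A))). Qed.

HB.instance Definition _ A :=
  GRing.isZmodMorphism.Build M (quot_span A) (quot_pi A)
    (quot_pi_zmod_morphism A).

Lemma quot_pi_eq A x y : (quot_pi A x = quot_pi A y) <-> span A (x - y).
Proof.
by split=> [/eqP|Axy]; [|apply/eqP];
  rewrite /quot_pi -Quotient.idealrBE; [move/asboolP | apply/asboolP].
Qed.

Lemma quot_pi_gen A x : A x -> quot_pi A x = 0.
Proof.
by move=> Ax; rewrite -(raddf0 (quot_pi A)); apply/quot_pi_eq;
  rewrite subr0; apply: span_gen.
Qed.

(* meaningful when f is additive and vanishes on A *)
Definition quot_lift (N : zmodType) (A : set M) (f : M -> N)
  (x : quot_span A) : N := f (repr (x : Quotient.quot (spanb A))).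

Lemma quot_liftE (N : zmodType) A (f : {additive M -> N}) x :
  (forall a, A a -> f a = 0) -> quot_lift f (quot_pi A x) = f x.
Proof.
move=> fA; have fs a : span A a -> f a = 0.
  elim=> [b /fA //||b c _ fb _ fc]; first exact: raddf0.
  by rewrite raddfB fb fc subr0.
apply/eqP; rewrite -subr_eq0 -raddfB; apply/eqP/fs/quot_pi_eq.
exact: reprK.
Qed.

Lemma quot_piP A (x : quot_span A) : exists y, x = quot_pi A y.
Proof. by exists (repr (x : Quotient.quot (spanb A))); rewrite /quot_pi reprK. Qed.

Lemma quot_lift_zmod_morphism (N : zmodType) A (f : {additive M -> N}) :
  (forall a, A a -> f a = 0) -> zmod_morphism (@quot_lift N A f).
Proof.
move=> fA x y; have [[a ->] [b ->]] := (quot_piP x, quot_piP y).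
by rewrite -raddfB !quot_liftE // raddfB.
Qed.

End Span.

Section FreeLift.
Variables (K : choiceType) (M : zmodType).

Definition fgen (x : K) : {freeg K} := Freeg [:: (1, x)].

Definition free_lift (f : K -> M) : {freeg K} -> M := @fglift int (zmodule M) K f.

Lemma free_lift_zmod_morphism f : zmod_morphism (free_lift f).
Proof. exact: (@lift_is_additive int K (zmodule M) f). Qed.

HB.instance Definition _ f :=
  GRing.isZmodMorphism.Build {freeg K} M (free_lift f)
    (free_lift_zmod_morphism f).

Lemma free_liftE f x : free_lift f (fgen x) = f x.
Proof. by rewrite /free_lift liftU scale1r. Qed.

End FreeLift.

Section Hom.
Variables U V : zmodType.

Definition is_homb : {pred U -> V} := fun f => `[< zmod_morphism f >].

Lemma is_homb_closed : zmod_closed is_homb.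
Proof.
split=> [|f g /asboolP hf /asboolP hg]; apply/asboolP=> x y.
  by rewrite /= subr0.
rewrite !fctE hf hg !opprD !opprK -!addrA; congr (_ + _).
by rewrite addrCA.
Qed.

HB.instance Definition _ := GRing.isZmodClosed.Build (U -> V) is_homb is_homb_closed.

Record Hom := MkHom { hom_fun :> U -> V; _ : hom_fun \in is_homb }.

HB.instance Definition _ := [isSub for hom_fun].
HB.instance Definition _ := [Choice of Hom by <:].
HB.instance Definition _ := [SubChoice_isSubZmodule of Hom by <:].

Lemma hom_zmod_morphism (f : Hom) : zmod_morphism f.
Proof. by case: f => f /= /asboolP. Qed.

HB.instance Definition _ (f : Hom) :=
  GRing.isZmodMorphism.Build U V f (hom_zmod_morphism f).

Definition hom_of (f : U -> V) (hf : zmod_morphism f) : Hom :=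
  @MkHom f (asboolT hf).

End Hom.

Section Tensor.
Variables M N : zmodType.

Inductive tensor_rel : set {freeg (M * N)%type} :=
| tensor_relDl x y z :
    tensor_rel (fgen (x + y, z) - fgen (x, z) - fgen (y, z))
| tensor_relDr x y z :
    tensor_rel (fgen (x, y + z) - fgen (x, y) - fgen (x, z)).

Definition tensor : zmodType := quot_span tensor_rel.

Definition tens (x : M) (y : N) : tensor := quot_pi tensor_rel (fgen (x, y)).

Lemma tensDl x y z : tens (x + y) z = tens x z + tens y z.
Proof.
apply/eqP; rewrite -subr_eq0 opprD addrA -!raddfB; apply/eqP.
exact/quot_pi_gen/tensor_relDl.
Qed.

Lemma tensDr x y z : tens x (y + z) = tens x y + tens x z.
Proof.
apply/eqP; rewrite -subr_eq0 opprD addrA -!raddfB; apply/eqP.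
exact/quot_pi_gen/tensor_relDr.
Qed.

End Tensor.

Section ExteriorPower.
Variables (k : nat) (M : zmodType).

Definition upd (v : 'I_k -> M) (i : 'I_k) (x : M) : {ffun 'I_k -> M} :=
  [ffun j => if j == i then x else v j].

Inductive ext_rel : set {freeg {ffun 'I_k -> M}} :=
| ext_relD v i x y :
    ext_rel (fgen (upd v i (x + y)) - fgen (upd v i x) - fgen (upd v i y))
| ext_rel_alt (v : {ffun 'I_k -> M}) i j of i != j & v i = v j :
    ext_rel (fgen v).

Definition ext : zmodType := quot_span ext_rel.

Definition wedge (v : 'I_k -> M) : ext := quot_pi ext_rel (fgen (finfun v)).

Lemma wedgeD v i x y :
  wedge (upd v i (x + y)) = wedge (upd v i x) + wedge (upd v i y).
Proof.
apply/eqP; rewrite -subr_eq0 opprD addrA -!raddfB; apply/eqP.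
by rewrite !ffunK; apply/quot_pi_gen/ext_relD.
Qed.

Lemma wedge_alt v i j : i != j -> v i = v j -> wedge v = 0.
Proof.
by move=> nij vij; apply/quot_pi_gen/(ext_rel_alt nij); rewrite !ffunE.
Qed.

(* s_0 /\ ... /\ s_(k-1) for a sequence of length k; sequences of any other
   length, which do not define an element of the k-th exterior power, are sent
   to 0 *)
Definition wedge_seq (s : seq M) : ext :=
  if size s == k then wedge (fun i => s`_i) else 0.

End ExteriorPower.

(* the induced map on k-th exterior powers when f is additive, see ext_mapE *)
Definition ext_map k (M N : zmodType) (f : M -> N) : ext k M -> ext k N :=
  quot_lift (free_lift (fun v : {ffun 'I_k -> M} => wedge (fun i => f (v i)))).

Lemma ext_map_rel k (M N : zmodType) (f : {additive M -> N}) a :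
  @ext_rel k M a ->
  free_lift (fun v : {ffun 'I_k -> M} => wedge (fun i => f (v i))) a = 0.
Proof.
case=> [v i x y|v i j nij vij]; last first.
  by rewrite free_liftE; apply: (wedge_alt nij); rewrite vij.
have E z : wedge (fun j => f (upd v i z j)) = wedge (upd (f \o v) i (f z)).
  by congr wedge; apply/funext=> j; rewrite !ffunE /=; case: eqP.
by rewrite !raddfB /= !free_liftE !E raddfD wedgeD -addrA -opprD subrr.
Qed.

Lemma ext_mapE k (M N : zmodType) (f : {additive M -> N}) (v : 'I_k -> M) :
  ext_map f (wedge v) = wedge (fun i => f (v i)).
Proof.
rewrite /ext_map [X in quot_lift _ X]/wedge quot_liftE; last exact: ext_map_rel.
by rewrite /= free_liftE; congr (wedge _); apply/funext=> i; rewrite ffunE.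
Qed.

Lemma ext_map_zmod_morphism k (M N : zmodType) (f : {additive M -> N}) :
  zmod_morphism (@ext_map k M N f).
Proof. by apply: quot_lift_zmod_morphism; apply: ext_map_rel. Qed.

(* projection onto P along Q: when M is the direct sum of the subgroups P and Q,
   proj P Q x is the unique y in P such that x - y is in Q *)
Definition proj (M : zmodType) (P Q : set M) (x : M) : M :=
  xget 0 [set y | P y /\ Q (x - y)].

Definition zbasis (M : zmodType) k (P : set M) (b : 'I_k -> M) : Prop :=
  [/\ forall i, P (b i),
      forall x, P x -> exists c : 'I_k -> int, x = \sum_(i < k) b i *~ c i &
      forall c : 'I_k -> int, \sum_(i < k) b i *~ c i = 0 -> forall i, c i = 0].

(* multiple edges and loops are allowed *)
Record graph := Graph {
  vert : finType;
  edge : finType;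
  src : edge -> vert;
  tgt : edge -> vert;
  einv : edge -> edge;
  einvK : involutive einv;
  einv_neq : forall e, einv e != e;
  src_inv : forall e, src (einv e) = tgt e;
  tgt_inv : forall e, tgt (einv e) = src e
}.

(* Eplus is E^+; edge_le is only constrained, as a total order, on Eplus *)
Record orientation (G : graph) := Orientation {
  Eplus : {set edge G};
  Eplus_inv : forall e, (einv e \in Eplus) = (e \notin Eplus);
  edge_le : rel (edge G);
  edge_le_refl : {in Eplus, reflexive edge_le};
  edge_le_anti : {in Eplus &, antisymmetric edge_le};
  edge_le_trans : {in Eplus & &, transitive edge_le};
  edge_le_total : {in Eplus &, total edge_le}
}.

Section Graph.
Variable G : graph.
Local Notation V := (vert G).
Local Notation E := (edge G).
Implicit Types (S F T : {set E}) (e : E).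

Definition subgraph S : bool := [forall e in S, einv e \in S].

Definition adj S : rel V :=
  [rel x y | [exists e in S, (src e == x) && (tgt e == y)]].

Definition ncomp S : nat := n_comp (adj S) V.

Definition connected : Prop := ncomp [set: E] = 1%N.

(* c is a simple cycle of (V, S): a nonempty closed path through pairwise
   distinct vertices, in which no edge is followed (cyclically) by its inverse;
   this allows loops, and pairs of parallel edges *)
Definition simple_cycle S (c : seq E) : bool :=
  [&& c != [::], all (mem S) c, uniq (map (@src G) c) &
      cycle [rel e e' | (tgt e == src e') && (e' != einv e)] c].

Definition acyclic S : bool := `[< forall c, ~~ simple_cycle S c >].

Definition forests (k : nat) : {set {set E}} :=
  [set S | [&& subgraph S, acyclic S & ncomp S == k.+1]].

Definition spanning_trees : {set {set E}} :=
  [set T | [&& subgraph T, acyclic T & ncomp T == 1%N]].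

Inductive C1_rel : set {freeg E} :=
| C1_rel_inv e : C1_rel (fgen e + fgen (einv e)).

Definition chains : zmodType := quot_span C1_rel.

Definition chain_of e : chains := quot_pi C1_rel (fgen e).

Definition cochains : zmodType := Hom chains int.

Lemma cochain_subproof (g : E -> int) (hg : forall e, g (einv e) = - g e) :
  zmod_morphism (@quot_lift _ int C1_rel (free_lift g)).
Proof.
apply: quot_lift_zmod_morphism => _ [e].
by rewrite raddfD /= !free_liftE hg subrr.
Qed.

Definition cochain (g : E -> int) (hg : forall e, g (einv e) = - g e) :
  cochains := hom_of (cochain_subproof hg).

Lemma cochainE g hg e : @cochain g hg (chain_of e) = g e.
Proof.
rewrite /= quot_liftE ?free_liftE /= ?free_liftE // => _ [e'].
by rewrite raddfD /= !free_liftE hg subrr.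
Qed.

Lemma dual_edge_subproof e e' :
  ((einv e' == e)%:Z - (einv e' == einv e)%:Z) =
  - ((e' == e)%:Z - (e' == einv e)%:Z).
Proof.
by rewrite opprB (inj_eq (can_inj (@einvK G))) (can2_eq (@einvK G) (@einvK G)).
Qed.

(* e^*: takes the value 1 at e, -1 at the inverse of e, and 0 at all other
   edges; for e in E^+ these are the elements of the basis dual to E^+ *)
Definition dual_edge e : cochains := cochain (dual_edge_subproof e).

Lemma delta_subproof (f : V -> int) e :
  f (tgt (einv e)) - f (src (einv e)) = - (f (tgt e) - f (src e)).
Proof. by rewrite src_inv tgt_inv opprB. Qed.

Definition delta (f : V -> int) : cochains := cochain (delta_subproof f).

Definition cochains_on S : set cochains :=
  span [set dual_edge e | e in [set` S]].

Definition coboundaries : set cochains := range delta.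

Definition coboundaries_off F : set cochains :=
  (coboundaries `&` cochains_on (~: F)%SET)%classic.

Definition B_proj T : cochains -> cochains :=
  proj coboundaries (cochains_on (~: T)%SET).

(* the wedge product of the dual edges of S :&: E^+, in increasing order; it is
   an element of the k-th exterior power if k = #|S :&: E^+| *)
Definition dual_wedge (o : orientation G) (k : nat) S : ext k cochains :=
  wedge_seq k [seq dual_edge e | e <- sort (edge_le o) (enum (S :&: Eplus o)%SET)].

End Graph.

(* Main.v *)
(** Expand [det beta] on the basis of wedges [e*_A], for [A] a set of [k] edges
of [E^+]; the coefficient [m_A] is the minor of the values of the [beta i] on
[A].  This minor vanishes unless [F u A] is a spanning tree [T] and [A] is
disjoint from [F]: a disconnection of [F u A] gives an element of [B^1(G, F)]
vanishing on [A] (a relation between rows), a simple cycle in [F u A] gives a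
relation between columns.  If [T] is a spanning tree, the cochains [B_T e*],
[e] in [A = T \ F], form another basis of [B^1(G, F)], in which coordinates are
the values on [A]; hence [m_A = 1] or [-1], and [m_A det beta = B_T^k (e*_A)],
so that [det beta (x) m_A e*_A = B_T^k (e*_A) (x) e*_A]. *)

From HB Require Import structures.
From mathcomp Require Import all_boot all_order all_fingroup all_algebra.
From mathcomp Require Import ring_quotient boolp classical_sets functions freeg.
Require Import Defs.

Import GRing.Theory.
Local Open Scope ring_scope.

(** * Expansions in exterior powers *)

Section Exterior.
Context {k : nat} {M : zmodType}.
Implicit Types (v : 'I_k -> M).

(** The wedge as a function of one slot, named so that it can carry an additive structure and sums
    and integer multiples can be pulled out of it. *)
Definition wedge_slot v i x := wedge (upd v i x).

Lemma wedge_slot_zmod_morphism v i : zmod_morphism (wedge_slot v i).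
Proof.
by move=> x y; apply/esym/eqP; rewrite subr_eq /wedge_slot -wedgeD subrK.
Qed.

HB.instance Definition _ v i :=
  GRing.isZmodMorphism.Build M (ext k M) (wedge_slot v i)
    (wedge_slot_zmod_morphism v i).

Lemma upd_id v i : upd v i (v i) = v :> (_ -> _).
Proof. by apply/funext => j; rewrite ffunE; case: eqP => [->|]. Qed.

Lemma wedge_tperm v i j : i != j -> wedge (v \o tperm i j) = - wedge v.
Proof.
move=> nij; pose w a b := wedge (upd (upd v i a) j b).
have wE a b : w a b = wedge (upd (upd v j b) i a).
  congr wedge; apply/funext => l; rewrite !ffunE.
  by case: (eqVneq l i) => [->|//]; rewrite (negbTE nij).
have waa a : w a a = 0.
  by apply: (wedge_alt nij); rewrite !ffunE eqxx (negbTE nij) eqxx.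
have wD a b c : w (a + b) c = w a c + w b c by rewrite !wE wedgeD.
have wDr a b c : w a (b + c) = w a b + w a c by rewrite /w wedgeD.
(* Polarization: expanding the alternating identity at a sum leaves two cross terms, which must
   cancel. *)
have := waa (v i + v j).
rewrite wD !wDr !waa add0r addr0 addrC => /eqP; rewrite addr_eq0 => /eqP wji.
have -> : wedge v = w (v i) (v j).
  congr wedge; apply/funext => l; rewrite !ffunE.
  by do 2![case: eqP => [->|]//].
rewrite -wji; congr wedge; apply/funext => l.
rewrite /= !ffunE; case: tpermP => [->|->|/eqP/negbTE-> /eqP/negbTE->] //.
  by rewrite eqxx (negbTE nij).
by rewrite eqxx.
Qed.

Lemma wedge_perm v (s : 'S_k) : wedge (v \o s) = wedge v *~ (-1) ^+ s.
Proof.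
have [ts -> /=] := prod_tpermP s; elim: ts v => [|t ts IHts] v /=.
  rewrite big_nil odd_perm1 mulr1z => _; congr wedge.
  by apply/funext => i /=; rewrite perm1.
case/andP => dt dts; rewrite big_cons odd_permM odd_tperm dt.
have -> : v \o (tperm t.1 t.2 * \prod_(t0 <- ts) tperm t0.1 t0.2)%g =
  (v \o (\prod_(t0 <- ts) tperm t0.1 t0.2)%g) \o tperm t.1 t.2.
  by apply/funext => i /=; rewrite permM.
by rewrite wedge_tperm // IHts // signr_addb mulN1r mulrNz.
Qed.

Section Expand.
Context {I : finType}.
Variables (u : I -> M) (a : 'I_k -> I -> int).

(** Form suited to induction on the list [r] of expanded slots: elsewhere [g] is pinned to an
    arbitrary [d], so that it encodes exactly the choices made on [r]. *)
Lemma wedge_expand_slots (d : 'I_k -> I) (r : seq 'I_k) v : uniq r ->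
  (forall i, i \in r -> v i = \sum_j u j *~ a i j) ->
  wedge v = \sum_(g : {ffun 'I_k -> I} | [forall (i | i \notin r), g i == d i])
    wedge (fun i => if i \in r then u (g i) else v i) *~ \prod_(i <- r) a i (g i).
Proof.
elim: r v => [|i r IHr] v /=.
  move=> _ _; rewrite (big_pred1 (finfun d)) => [|g].
    by rewrite big_nil mulr1z.
  apply/forallP/eqP => [gd|-> i]; last by rewrite ffunE eqxx.
  by apply/ffunP => i; rewrite ffunE; apply/eqP/(implyP (gd i)).
case/andP => nir ur vE.
have -> : wedge v = \sum_j wedge_slot v i (u j) *~ a i j.
  rewrite -{1}(upd_id v i) vE ?mem_head // -/(wedge_slot _ _ _) raddf_sum.
  by apply: eq_bigr => j _; rewrite raddfMz.
rewrite [RHS](partition_big (fun g : {ffun 'I_k -> I} => g i) predT) //=.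
apply: eq_bigr => j _; rewrite /wedge_slot IHr //; last first.
  move=> l lr; rewrite ffunE; case: eqP => [li|_].
      by rewrite -li lr in nir.
  by rewrite vE // inE lr orbT.
(* The induction hypothesis pins [g i] to [d i], the goal pins it to [j]; resetting the value at [i]
   matches the two index sets. *)
pose set_i x (g : {ffun 'I_k -> I}) := [ffun l => if l == i then x else g l].
rewrite [RHS](reindex_onto (set_i j) (set_i (d i))); last first.
  move=> g /andP[_ /eqP gi]; apply/ffunP => l; rewrite !ffunE.
  by case: eqP => [->|].
rewrite mulrz_suml; apply: eq_big => [g|g _].
  apply/forallP/andP => [gd|[/andP[/forallP gd _] /eqP gK] l].
    split; [apply/andP; split; last by rewrite /set_i ffunE eqxx | ]; last first.
      apply/eqP/ffunP => l; rewrite !ffunE; case: eqP => // ->.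
      by have /implyP/(_ nir)/eqP := gd i.
    apply/forallP => l; apply/implyP; rewrite inE negb_or => /andP[/negbTE nl lr].
    by rewrite ffunE nl (implyP (gd l)).
  apply/implyP => lr; move/ffunP/(_ l): gK; rewrite !ffunE.
  case: eqVneq => [-> <-|nli _] //.
  by have := gd l; rewrite inE (negbTE nli) /= ffunE (negbTE nli) => /implyP ->.
rewrite big_cons -mulrzA [_ * a i j]mulrC {2}/set_i ffunE eqxx.
congr (wedge _ *~ (_ * _)).
  apply/funext => l; rewrite inE !ffunE; case: (eqVneq l i) => //= ->.
  by rewrite (negbTE nir).
by apply: eq_big_seq => l lr; rewrite ffunE; case: eqP => // li;
  rewrite -li lr in nir.
Qed.

Lemma wedge_expand : wedge (fun i => \sum_j u j *~ a i j) =
  \sum_(g : {ffun 'I_k -> I}) wedge (u \o g) *~ \prod_i a i (g i).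
Proof.
have [g0 _|noffun] := pickP {: {ffun 'I_k -> I}}.
  rewrite (wedge_expand_slots g0 _ _ (index_enum_uniq _)) //.
  apply: eq_big => [g|g _]; last first.
    by congr (wedge _ *~ _); apply/funext => i; rewrite mem_index_enum.
  by apply/forallP => i; rewrite mem_index_enum.
(* If there is no function from ['I_k] to [I], then [I] is empty and [k > 0]: the right side is an
   empty sum, and the slots on the left are 0. *)
rewrite [RHS]big_pred0 //.
have [i _|noi] := pickP {: 'I_k}; last first.
  have g (i : 'I_k) : I by have := noi i.
  by have := noffun (finfun g).
have noI (j : I) : False by have := noffun [ffun=> j].
have -> : (fun i => \sum_j u j *~ a i j) = upd (fun=> 0) i 0 :> ('I_k -> M).
  by apply/funext => l; rewrite ffunE if_same big1 // => j; case: (noI j).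
exact: (raddf0 (wedge_slot _ i)).
Qed.

(** As [s] is injective, the functions with its image are the [s \o p] for permutations [p]; the
    signs from reordering the wedges give the Leibniz formula. *)
Lemma sum_wedge_im_perm (s : 'I_k -> I) : injective s ->
  \sum_(g : {ffun 'I_k -> I} |
      [set g i | i : 'I_k]%SET == [set s i | i : 'I_k]%SET)
    wedge (u \o g) *~ \prod_i a i (g i) =
  wedge (u \o s) *~ \det (\matrix_(i, j) a i (s j)).
Proof.
move=> sI; pose h (p : 'S_k) := [ffun i => s (p i)].
have him p : [set h p i | i : 'I_k]%SET = [set s i | i : 'I_k]%SET.
  apply/setP => x; apply/imsetP/imsetP => -[i _ ->].
    by exists (p i); rewrite ?ffunE.
  by exists (p^-1%g i); rewrite ?ffunE ?permKV.
have hinj : injective h.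
  move=> p q /ffunP pq; apply/permP => i; apply: sI.
  by have := pq i; rewrite !ffunE.
rewrite (eq_bigl (mem [set h p | p : 'S_k]%SET)) => [|g].
  rewrite big_imset /=; last by move=> ? ? _ _; apply: hinj.
  rewrite /determinant mulrz_sumr; apply: eq_bigr => p _.
  have -> : wedge (u \o h p) = wedge ((u \o s) \o p).
    by congr wedge; apply/funext => i; rewrite /= ffunE.
  rewrite wedge_perm -mulrzA; congr (_ *~ (_ * _)).
  by apply: eq_bigr => i _; rewrite mxE ffunE.
apply/eqP/imsetP => [gs|[p _ ->]]; last exact: him.
have gP i : exists j, g i = s j.
  have : g i \in [set s i | i : 'I_k]%SET by rewrite -gs imset_f.
  by case/imsetP => j _ ->; exists j.
have [f fP] := choice gP.
have gI : injective g.
  have /imset_injP gI : #|[set g i | i : 'I_k]%SET| == #|'I_k|.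
    by rewrite gs card_imset.
  by move=> i j gij; apply: gI.
have fI : injective f by move=> i j fij; apply: gI; rewrite !fP fij.
by exists (perm fI) => //; apply/ffunP => i; rewrite ffunE permE fP.
Qed.

Lemma wedge_comp_neq0_inj (g : 'I_k -> I) : wedge (u \o g) != 0 -> injective g.
Proof.
move=> wg; apply/injectiveP; apply: contraR wg => /injectivePn[i [j nij gij]].
by rewrite (wedge_alt nij) //= gij.
Qed.

(** Group the functions [g] by image, each set being ordered by [t]. If [A] does not have [k]
    elements, no injective [g] has image [A], and [wedge_seq] takes its default value 0. *)
Lemma wedge_expand_sets (t : {set I} -> seq I) :
  (forall A, uniq (t A)) -> (forall A, t A =i A) ->
  wedge (fun i => \sum_j u j *~ a i j) =
  \sum_A wedge_seq k [seq u j | j <- t A] *~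
    \det (\matrix_(i < k, j < k) [seq a i l | l <- t A]`_j).
Proof.
move=> tU tA; rewrite wedge_expand.
rewrite (partition_big (fun g : {ffun 'I_k -> I} =>
  [set g i | i : 'I_k]%SET) predT) //=.
apply: eq_bigr => A _; have [tk|tk] := boolP (size (t A) == k); last first.
  rewrite /wedge_seq size_map (negbTE tk) mul0rz big1 // => g /eqP gA.
  have [->|/wedge_comp_neq0_inj gI] := eqVneq (wedge (u \o g)) 0.
    by rewrite mul0rz.
  case/negP: tk; rewrite -(card_uniqP (tU A)) (eq_card (tA A)) -gA.
  by rewrite card_imset // card_ord.
pose s := tnth (Tuple tk).
have sI : injective s by apply/tuple_uniqP/tU.
have sA : A = [set s i | i : 'I_k]%SET.
  apply/setP => x; rewrite -[x \in A]tA.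
  apply/(tnthP (Tuple tk))/imsetP => [[i ->]|[i _ ->]];
  by exists i.
rewrite {1}sA sum_wedge_im_perm // /wedge_seq size_map tk; congr (wedge _ *~ _).
  apply/funext => i; rewrite /= -(tnth_map u (Tuple tk)) (tnth_nth 0) //.
congr (\det _); apply/matrixP => i j; rewrite !mxE.
by rewrite -(tnth_map (a i) (Tuple tk)) (tnth_nth 0).
Qed.

End Expand.

(** A self-map of ['I_k] that is not surjective repeats a factor and contributes 0; the others are
    permutations. *)
Lemma wedge_det (u : 'I_k -> M) (A : 'M[int]_k) :
  wedge (fun i => \sum_j u j *~ A i j) = wedge u *~ \det A.
Proof.
rewrite wedge_expand (bigID (fun g : {ffun 'I_k -> 'I_k} =>
  [set g i | i : 'I_k]%SET == [set id i | i : 'I_k]%SET)) /=.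
rewrite (sum_wedge_im_perm _ _ id) // [X in _ + X]big1 ?addr0 => [|g gT].
  by congr (wedge _ *~ \det _); apply/matrixP => i j; rewrite mxE.
have [->|/wedge_comp_neq0_inj gI] := eqVneq (wedge (u \o g)) 0.
  by rewrite mul0rz.
case/negP: gT; rewrite eqEcard !card_imset // leqnn andbT.
by apply/fintype.subsetP => x _; apply/imsetP; exists x.
Qed.

End Exterior.

(** * Cochains and their values on edges *)

Section Tensor.
Context {M N : zmodType}.

Lemma tens_zmod_morphism (x : M) : zmod_morphism (@tens M N x).
Proof. by move=> y z; apply/esym/eqP; rewrite subr_eq -tensDr subrK. Qed.

HB.instance Definition _ (x : M) :=
  GRing.isZmodMorphism.Build N (tensor M N) (@tens M N x) (tens_zmod_morphism x).

Lemma tens_mulzl (x : M) (y : N) n : tens (x *~ n) y = tens x (y *~ n).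
Proof.
have addl : zmod_morphism (fun x : M => tens x y).
  by move=> a b; apply/esym/eqP; rewrite subr_eq -tensDl subrK.
pose tl : {additive M -> tensor M N} :=
  HB.pack (fun x : M => tens x y) (GRing.isZmodMorphism.Build _ _ _ addl).
by rewrite (raddfMz (tens x)) -[LHS]/(tl _) (raddfMz tl).
Qed.

End Tensor.

Lemma freeg_ext {K : choiceType} {M : zmodType} (f g : {additive {freeg K} -> M}) :
  (forall x, f (fgen x) = g (fgen x)) -> f =1 g.
Proof.
move=> fg D; rewrite -(freeg_sumE D) !raddf_sum; apply: eq_bigr => x _.
suff E : << coeff x D *g x >> = fgen x *~ coeff x D.
  by rewrite E !raddfMz fg.
apply/eqP/freeg_eqP => y; rewrite raddfMz /= !coeffU mul1r -mulrzl /=.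
by rewrite intz.
Qed.

(** The cochain comes last, so that evaluation at an edge is an additive map; cochains are compared
    through these values. *)
Definition value {G : graph} (e : edge G) (x : cochains G) : int :=
  x (chain_of e).

Arguments value : simpl never.

Section Cochains.
Context {G : graph}.
Local Notation E := (edge G).
Implicit Types (x y : cochains G) (S F T : {set E}) (e : E).


Lemma value_zmod_morphism e : zmod_morphism (value e).
Proof. by move=> x y. Qed.

HB.instance Definition _ e :=
  GRing.isZmodMorphism.Build (cochains G) int (value e) (value_zmod_morphism e).

Lemma value_inv e x : value (einv e) x = - value e x.
Proof.
apply/eqP; rewrite -addr_eq0 addrC /value /chain_of -!raddfD.
by rewrite /= (quot_pi_gen (C1_rel_inv e)) raddf0.
Qed.

Lemma value_delta f e : value e (delta f) = f (tgt e) - f (src e).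
Proof. exact: cochainE. Qed.

Lemma value_dual e e' :
  value e' (dual_edge e) = (e' == e)%:Z - (e' == einv e)%:Z.
Proof. exact: cochainE. Qed.

Lemma cochain_ext x y : (forall e, value e x = value e y) -> x = y.
Proof.
move=> xy; apply/val_inj/funext => c /=; have [D ->] := quot_piP c.
exact: (freeg_ext (x \o quot_pi (@C1_rel G)) (y \o quot_pi (@C1_rel G))).
Qed.

Lemma value_dual_diag e : value e (dual_edge e) = 1.
Proof. by rewrite value_dual eqxx eq_sym (negbTE (einv_neq e)) subr0. Qed.

Lemma value_dual0 e e' : e' != e -> e' != einv e -> value e' (dual_edge e) = 0.
Proof. by rewrite value_dual => /negbTE-> /negbTE->. Qed.

Variable o : orientation G.

Lemma Eplus_neq_inv e e' : e \in Eplus o -> e' \in Eplus o -> e' != einv e.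
Proof. by move=> eE; apply: contraTneq => ->; rewrite Eplus_inv eE. Qed.

Lemma cochain_ext_Eplus x y :
  {in Eplus o, forall e, value e x = value e y} -> x = y.
Proof.
move=> xy; apply: cochain_ext => e; have [/xy //|] := boolP (e \in Eplus o).
by rewrite -Eplus_inv => /xy; rewrite !value_inv => /oppr_inj.
Qed.

Lemma cochain_sum x :
  x = \sum_(e in Eplus o) dual_edge e *~ value e x.
Proof.
apply: cochain_ext_Eplus => e eE; rewrite raddf_sum (bigD1 e) //= raddfMz /=.
rewrite value_dual_diag big1 ?addr0 /= ?intz // => e' /andP[e'E ne].
by rewrite raddfMz /= value_dual0 ?mul0rz // 1?eq_sym // eq_sym Eplus_neq_inv.
Qed.

(** Stability under inversion enters because [dual_edge e] is also nonzero at [einv e]. Conversely,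
    only the terms of [cochain_sum] at edges of [S] survive. *)
Lemma cochains_onP S x : subgraph S ->
  cochains_on S x <-> (forall e, e \notin S -> value e x = 0).
Proof.
move=> /forall_inP Sinv; split=> [+ e neS|x0].
  elim=> [_ [e' /= e'S <-]||y z _ y0 _ z0]; last by rewrite raddfB /= y0 z0.
    by apply: value_dual0; apply: contraNneq neS => ->; rewrite ?Sinv.
  exact: raddf0.
suff : x \in spanb [set dual_edge e | e in [set` S]]%classic by move/asboolP.
rewrite (cochain_sum x) rpred_sum // => e _.
have [eS|/x0->] := boolP (e \in S); last by rewrite mulr0z rpred0.
by apply/rpredMz/asboolP/span_gen; exists e.
Qed.

End Cochains.

(** * Connectedness, cycles and coboundaries *)

Section Graph.
Context {G : graph}.
Local Notation V := (vert G).
Local Notation E := (edge G).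
Implicit Types (x y : cochains G) (S F T : {set E}) (e : E) (f : V -> int).

Lemma subgraph_inv S e : subgraph S -> (einv e \in S) = (e \in S).
Proof. by move/forall_inP=> Si; apply/idP/idP => /Si //; rewrite einvK. Qed.

Lemma adj_edge S e : e \in S -> adj S (src e) (tgt e).
Proof. by move=> eS; apply/exists_inP; exists e => //; rewrite !eqxx. Qed.

Lemma adj_connect_sym S : subgraph S -> connect_sym (adj S).
Proof.
move=> Ssub; apply: sym_connect_sym => u v.
by apply/exists_inP/exists_inP => -[e eS /andP[/eqP<- /eqP<-]];
  exists (einv e); rewrite ?subgraph_inv // src_inv tgt_inv !eqxx.
Qed.

Lemma connect_const S f u v :
  (forall e, e \in S -> value e (delta f) = 0) -> connect (adj S) u v -> f u = f v.
Proof.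
move=> f0 /connectP[p + ->]; elim: p u => //= w p IHp u /andP[uw /IHp<-].
case/exists_inP: uw => e /f0; rewrite value_delta => /eqP.
by rewrite subr_eq0 => /eqP fe /andP[/eqP<- /eqP<-].
Qed.

(** [inhabited V] rules out the empty graph, which has no component at all. *)
Lemma ncomp1P S : subgraph S ->
  ncomp S = 1%N <-> inhabited V /\ forall u v, connect (adj S) u v.
Proof.
move=> /adj_connect_sym Ssym; split=> [/mem_card1[r rP]|[[v] Sc]].
  have rootr u : fingraph.root (adj S) u = r.
    by have := rP (fingraph.root (adj S) u); rewrite !inE roots_root // => /esym/eqP.
  by split=> [|u w]; [exists | rewrite -root_connect // !rootr].
apply: (@eq_card1 _ (fingraph.root (adj S) v)) => u; rewrite !inE andbT.
apply/eqP/eqP => [<-|->]; last exact: (fingraph.root_root Ssym).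
exact/(fingraph.rootP Ssym).
Qed.

(** Its coboundary is the cut around a component of [S]; such cuts give both the fundamental
    coboundaries of a tree and the row relations of a disconnected minor. *)
Definition component_ind S v : V -> int := fun u => (connect (adj S) v u)%:Z.

Lemma value_component_ind S v e :
  subgraph S -> e \in S -> value e (delta (component_ind S v)) = 0.
Proof.
move=> Ssub eS; rewrite value_delta /component_ind.
have/connect1 c1 := adj_edge _ _ eS.
by rewrite (same_connect_r (adj_connect_sym _ Ssub) c1) subrr.
Qed.

Lemma path_edges S u p : path (adj S) u p ->
  exists c : seq E, [/\ all (mem S) c, map (@src G) c = belast u p
                      & map (@tgt G) c = p].
Proof.
elim: p u => [|w p IHp] u /=; first by exists [::].
case/andP => /exists_inP[e eS /andP[/eqP<- /eqP<-]] /IHp[c [cS cs ct]].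
by exists (e :: c); rewrite /= eS cs ct.
Qed.

Local Notation next_rel := [rel e e' | (tgt e == src e') && (e' != einv e)].

(** Following an edge by its inverse would return to the vertex just left, against distinctness.
    Only the first transition needs [hd], since [src e] is not among the vertices listed. *)
Lemma simple_path_next (e : E) p (c : seq E) : uniq (tgt e :: p) ->
    map (@src G) c = belast (tgt e) p -> map (@tgt G) c = p ->
    (forall b c', c = b :: c' -> b != einv e) ->
  path next_rel e c.
Proof.
elim: c e p => // a c IHc e [//|w p] /= /andP[+ up] [sa sc] [ta tc] hd.
rewrite inE negb_or => /andP[_ np].
rewrite sa eqxx (hd a c) //=; apply: (IHc a p); rewrite ?ta // => b c' cE.
apply: contraNneq np => bE; rewrite -sa -[src a]tgt_inv -bE.
by move: tc; rewrite cE /= => <-; rewrite mem_head.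
Qed.

(** Otherwise a path with distinct vertices from [tgt e] to [src e], preceded by [e], would be a
    simple cycle of [T]. *)
Lemma acyclic_sep T e : subgraph T -> acyclic T -> e \in T ->
  ~~ connect (adj (T :\: [set e; einv e])) (tgt e) (src e).
Proof.
move=> Tsub /asboolP Tac eT; apply/negP => /connectP[p0 /shortenP[p pp up _] pe].
have [c [cS cs ct]] := path_edges _ _ _ pp.
apply/negP: (Tac (e :: c)); rewrite negbK; apply/and4P; split => //=.
- rewrite eT; by apply: sub_all cS => a /setDP[].
- rewrite cs pe -rcons_uniq -lastI //.
rewrite rcons_path (simple_path_next e p) //=; last first.
  move=> b c' cE; move: cS; rewrite cE /= !inE => /andP[/andP[]].
  by rewrite negb_or => /andP[].
rewrite -(last_map (@tgt G)) ct pe eqxx /=.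
(* No backtracking where the cycle closes up: a loop [e] differs from its inverse, and otherwise the
   last edge was chosen outside [e] and [einv e]. *)
case/lastP: c cS {cs ct} => [|c a]; first by rewrite eq_sym einv_neq.
rewrite all_rcons last_rcons => /andP[].
rewrite !inE negb_or => /andP[/andP[_ ae] _] _.
by apply: contra ae => /eqP->; rewrite einvK.
Qed.

(** Deleting [e] and [einv e] separates the ends of [e]; the indicator of the side of [tgt e] jumps
    by 1 along [e] and is constant along the remaining edges of [T]. *)
Lemma fundamental_coboundary T e : subgraph T -> acyclic T -> e \in T ->
  exists x, [/\ coboundaries x, value e x = 1 &
    forall e', e' \in T -> e' != e -> e' != einv e -> value e' x = 0].
Proof.
move=> Tsub Tac eT; pose T' := T :\: [set e; einv e].
have T'sub : subgraph T'.
  apply/forall_inP => a; rewrite !inE !negb_or subgraph_inv //.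
  move=> /andP[/andP[ae ae'] ->].
  by rewrite (inj_eq (can_inj (@einvK G))) ae (can2_eq (@einvK G) (@einvK G)) ae'.
exists (delta (component_ind T' (tgt e))); split.
- by exists (component_ind T' (tgt e)).
- rewrite value_delta /component_ind connect0.
  by rewrite (negbTE (acyclic_sep _ _ _ _ _)).
- move=> a aT ae ae'; apply: value_component_ind => //.
  by rewrite !inE negb_or ae ae' aT.
Qed.

(** The differences of a potential telescope around a closed path. *)
Lemma simple_cycle_sum S c x : simple_cycle S c -> coboundaries x ->
  \sum_(e <- c) value e x = 0.
Proof.
move=> /and4P[+ _ _ +] [f _ <-]; case: c => // e c _; rewrite /= rcons_path.
case/andP => ec /andP[/eqP ce _].
suff -> : \sum_(a <- e :: c) value a (delta f) = f (tgt (last e c)) - f (src e).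
  by rewrite ce subrr.
elim: c e ec {ce} => [|b c IHc] e /=.
  by rewrite big_seq1 value_delta.
case/andP => /andP[/eqP eb _] /IHc IH; rewrite big_cons IH value_delta eb.
by rewrite addrC addrA subrK.
Qed.

(** Rotate [c] to start at [e]. The next edge is not [einv e], and a later [einv e] would have the
    same source as that next edge. *)
Lemma simple_cycle_inv S c e : simple_cycle S c -> e \in c -> einv e \notin c.
Proof.
move=> /and4P[_ _ cu cc] /rot_to[i c' cE].
move: cu cc; rewrite -(rot_uniq i) -map_rot -(rot_cycle i) cE -(mem_rot i) cE.
rewrite inE (negbTE (einv_neq e)) /=.
case: c' {cE} => // b c' /= /andP[_ /andP[nb _]].
case/andP => /andP[/eqP eb be] _; rewrite inE negb_or eq_sym be /=.
by apply: contra nb => ?; rewrite -eb -src_inv map_f.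
Qed.

Lemma simple_cycle_uniq S c : simple_cycle S c -> uniq c.
Proof. by case/and4P => _ _ /map_uniq. Qed.

Lemma coboundary_eq0 T x : subgraph T -> ncomp T = 1%N -> coboundaries x ->
  (forall e, e \in T -> value e x = 0) -> x = 0.
Proof.
move=> Tsub /(ncomp1P _ Tsub)[_ Tc] [f _ <-] x0; apply: cochain_ext => e.
by rewrite value_delta (connect_const _ _ _ _ x0 (Tc (tgt e) (src e))) subrr raddf0.
Qed.

Lemma coboundaries_offP (o : orientation G) F x : subgraph F ->
  coboundaries_off F x <->
  coboundaries x /\ (forall e, e \in F -> value e x = 0).
Proof.
move=> Fsub; have Fcsub : subgraph (~: F).
  by apply/forall_inP => e; rewrite !inE subgraph_inv.
rewrite /coboundaries_off; split=> -[xB xF]; split=> //.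
  by move=> e eF; apply: ((cochains_onP o _ _ Fcsub).1 xF); rewrite inE negbK.
by apply/(cochains_onP o _ _ Fcsub) => e; rewrite inE negbK; apply: xF.
Qed.

End Graph.

(** * The projection along a spanning tree *)

Section Projection.
Context {G : graph} (o : orientation G).
Local Notation E := (edge G).
Implicit Types (x y : cochains G) (S F T : {set E}) (e : E).

Lemma coboundariesB x y : coboundaries x -> coboundaries y -> coboundaries (x - y).
Proof.
move=> [f _ <-] [g _ <-]; exists (fun v => f v - g v) => //.
apply: cochain_ext => e; rewrite raddfB /= !value_delta.
by rewrite !opprB addrACA [RHS]addrACA (addrC (- g _)).
Qed.

Lemma coboundariesMz x n : coboundaries x -> coboundaries (x *~ n).
Proof.
move=> [f _ <-]; exists (fun v => f v *~ n) => //.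
by apply: cochain_ext => e; rewrite raddfMz /= !value_delta mulrzBl.
Qed.

Lemma coboundaries_sum (I : eqType) (r : seq I) (x : I -> cochains G) :
  (forall i, i \in r -> coboundaries (x i)) -> coboundaries (\sum_(i <- r) x i).
Proof.
have B0 : @coboundaries G 0.
  exists (fun=> 0) => //; apply: cochain_ext => e.
  by rewrite value_delta raddf0 subrr.
move=> xB; rewrite big_seq; elim/big_ind: _ => // y z yB zB.
rewrite -[z]opprK; apply: coboundariesB => //; rewrite -sub0r.
exact: coboundariesB.
Qed.

Context {T : {set E}} (Ttree : T \in spanning_trees G).

Lemma coboundary_eq_on x y : coboundaries x -> coboundaries y ->
  {in T, forall e, value e x = value e y} -> x = y.
Proof.
move: Ttree; rewrite inE => /and3P[Tsub _ /eqP Tn] xB yB xy.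
apply/eqP; rewrite -subr_eq0; apply/eqP/(coboundary_eq0 T) => //.
  exact: coboundariesB.
by move=> e eT; rewrite raddfB /= xy // subrr.
Qed.

(** [proj] is a choice with default 0, so the decomposition of [x] must be shown to exist: the
    fundamental coboundaries of [T], weighted by the values of [x], provide it. Summing over [E^+]
    counts each edge once. *)
Lemma B_projP x :
  coboundaries (B_proj T x) /\ {in T, forall e, value e (B_proj T x) = value e x}.
Proof.
move: (Ttree); rewrite inE => /and3P[Tsub Tac _].
have /choice[g gP] e : exists y, e \in T ->
    [/\ coboundaries y, value e y = 1 &
      forall e', e' \in T -> e' != e -> e' != einv e -> value e' y = 0].
  have [eT|_] := boolP (e \in T); last by exists 0.
  by have [y yP] := fundamental_coboundary _ _ Tsub Tac eT; exists y.
pose y := \sum_(e <- enum (T :&: Eplus o)) g e *~ value e x.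
have yB : coboundaries y.
  apply: coboundaries_sum => e; rewrite mem_enum inE => /andP[/gP[gB _ _] _].
  exact: coboundariesMz.
have yE e : e \in T -> e \in Eplus o -> value e y = value e x.
  move=> eT eE; rewrite /y big_enum /= raddf_sum (bigD1 e) ?inE ?eT //=.
  have [_ g1 _] := gP e eT.
  rewrite raddfMz /= g1 intz big1 ?addr0 // => a; rewrite inE -andbA.
  case/and3P => aT aE nae; have [_ _ g0] := gP a aT.
  by rewrite raddfMz /= g0 ?mul0rz // 1?eq_sym // eq_sym (Eplus_neq_inv o).
have yT e : e \in T -> value e y = value e x.
  move=> eT; have [/yE->//|] := boolP (e \in Eplus o).
  rewrite -Eplus_inv => /yE; rewrite subgraph_inv // => /(_ eT).
  by rewrite !value_inv => /oppr_inj.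
have Tcsub : subgraph (~: T).
  by apply/forall_inP => e; rewrite !inE subgraph_inv.
have : exists z, [set z | coboundaries z /\ cochains_on (~: T) (x - z)]%classic z.
  exists y; split=> //; apply/(cochains_onP o _ _ Tcsub) => e.
  by rewrite inE negbK => /yT yx; rewrite raddfB /= yx subrr.
case/(xgetPex 0) => zB /(cochains_onP o _ _ Tcsub) zT; split=> // e eT.
have := zT e; rewrite inE negbK raddfB => /(_ eT)/eqP.
by rewrite subr_eq0 => /eqP.
Qed.

Lemma B_proj_eq x y : coboundaries y ->
  {in T, forall e, value e y = value e x} -> B_proj T x = y.
Proof.
have [pB px] := B_projP x; move=> yB yx; apply: coboundary_eq_on => // e eT.
by rewrite px // yx.
Qed.

Lemma B_proj_zmod_morphism : zmod_morphism (@B_proj G T).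
Proof.
move=> x y; have [[xB xE] [yB yE]] := (B_projP x, B_projP y).
apply: B_proj_eq; first exact: coboundariesB.
by move=> e eT; rewrite !raddfB /= xE // yE.
Qed.

Lemma ext_map_B_proj k (v : 'I_k -> cochains G) :
  ext_map (B_proj T) (wedge v) = wedge (B_proj T \o v).
Proof.
pose f : {additive cochains G -> cochains G} :=
  HB.pack (@B_proj G T) (GRing.isZmodMorphism.Build _ _ _ B_proj_zmod_morphism).
exact: (ext_mapE f).
Qed.

Section CoboundariesOff.
Variables (F : {set E}) (k r : nat) (beta : 'I_k -> cochains G) (s : 'I_r -> E).
Hypotheses (Fsub : subgraph F) (FT : F \subset T).
Hypothesis betaP : zbasis (coboundaries_off F) beta.
Hypothesis sI : injective s.
Hypothesis sP : [set s i | i : 'I_r]%SET = (T :\: F) :&: Eplus o.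

(** These form a basis of [B^1(G, F)] whose coordinates are the values at the [s j], and [M]
    expresses [beta] in it. The lengths [r] and [k] are not yet known to agree. *)
Let g j := B_proj T (dual_edge (s j)).
Let M := \matrix_(i < k, j < r) value (s j) (beta i).

Lemma mem_complement_forest j : [/\ s j \in T, s j \notin F & s j \in Eplus o].
Proof.
have : s j \in [set s i | i : 'I_r]%SET by apply/imset_f.
by rewrite sP !inE -andbA => /and3P[].
Qed.

(** Coboundaries are determined by their values on [T]: on [F] both sides vanish, and at [s j] only
    the term of index [j] remains. *)
Lemma coboundary_off_sum x :
  coboundaries_off F x -> x = \sum_j g j *~ value (s j) x.
Proof.
case/(coboundaries_offP o _ _ Fsub) => xB xF; apply: coboundary_eq_on => //.
  apply: coboundaries_sum => j _; apply: coboundariesMz.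
  by have [] := B_projP (dual_edge (s j)).
suff xE e : e \in T -> e \in Eplus o ->
    value e x = value e (\sum_j g j *~ value (s j) x).
  move: (Ttree); rewrite inE => /and3P[Tsub _ _].
  move=> e eT; have [/xE->//|] := boolP (e \in Eplus o).
  rewrite -Eplus_inv => /xE; rewrite subgraph_inv // => /(_ eT).
  by rewrite !value_inv => /oppr_inj.
move=> eT eE; rewrite raddf_sum.
have gE j : value e (g j) = value e (dual_edge (s j))
  by have [_ ->] := B_projP (dual_edge (s j)).
have [eF|eF] := boolP (e \in F).
  rewrite xF // big1 // => j _; rewrite raddfMz /= gE value_dual0 ?mul0rz //.
    by apply: contraTneq eF => ->; have [] := mem_complement_forest j.
  by rewrite (Eplus_neq_inv o) //; have [] := mem_complement_forest j.
have : e \in [set s i | i : 'I_r]%SET by rewrite sP !inE eF eT.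
case/imsetP => j _ ej; rewrite (bigD1 j) //= raddfMz /= gE ej value_dual_diag.
rewrite intz big1 ?addr0 // => i ij; rewrite raddfMz /= -ej gE value_dual0 ?mul0rz //.
  by rewrite ej (inj_eq sI) eq_sym.
by rewrite (Eplus_neq_inv o) //; have [] := mem_complement_forest i.
Qed.

(** [C] holds the coordinates of the [g j] in [beta]. Evaluating [g i] at [s j] gives [C *m M = 1];
    expanding [beta i] through [g] and using freeness of [beta] gives [M *m C = 1]. *)
Lemma value_matrix_inv : exists C : 'M[int]_(r, k), C *m M = 1%:M /\ M *m C = 1%:M.
Proof.
have [betaF beta_gen beta_free] := betaP.
have gF j : coboundaries_off F (g j).
  have [gB gE] := B_projP (dual_edge (s j)).
  apply/(coboundaries_offP o _ _ Fsub); split=> // e eF.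
  have [_ sF _] := mem_complement_forest j.
  rewrite gE ?(fintype.subsetP FT) // value_dual0 //.
    by apply: contraNneq sF => <-.
  by apply: contraNneq sF => eE; rewrite -subgraph_inv // -eE.
have [c cP] := choice (fun j => beta_gen _ (gF j)).
pose C := \matrix_(j < r, i < k) c j i.
exists C; split; apply/matrixP => i j.
  rewrite !mxE; have [sT _ sE] := mem_complement_forest j.
  have : value (s j) (g i) = (i == j)%:R.
    have [_ ->] // := B_projP (dual_edge (s i)).
    have [->|ij] := eqVneq; first exact: value_dual_diag.
    rewrite value_dual0 //; first by rewrite (inj_eq sI) eq_sym.
    by rewrite (Eplus_neq_inv o) //; have [] := mem_complement_forest i.
  move=> <-; rewrite cP raddf_sum; apply: eq_bigr => l _.
  by rewrite !mxE raddfMz /= -mulrzr intz mulrC.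
apply/eqP; rewrite -subr_eq0; apply/eqP.
have := beta_free (fun l => (M *m C) i l - 1%:M i l); apply.
have : beta i = \sum_l beta l *~ (M *m C) i l.
  rewrite [LHS]coboundary_off_sum //.
  under eq_bigr => j' _ do rewrite cP mulrz_suml.
  rewrite exchange_big; apply: eq_bigr => l _; rewrite mxE mulrz_sumr.
  by apply: eq_bigr => j' _; rewrite !mxE -mulrzA mulrC.
under [X in _ -> X = _]eq_bigr => l _ do rewrite mulrzBr.
move=> bE; rewrite sumrB -bE (bigD1 i) //= mxE eqxx mulr1z big1 => [|l li].
  by rewrite addr0 subrr.
by rewrite mxE eq_sym (negbTE li) mulr0z.
Qed.

Lemma card_complement_forest : r = k.
Proof.
have [C [/mulmx1_min rk /mulmx1_min kr]] := value_matrix_inv.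
by apply/eqP; rewrite eqn_leq rk.
Qed.

End CoboundariesOff.

Lemma wedge_basis_tree {F k} {beta : 'I_k -> cochains G} {s : 'I_k -> E} :
  subgraph F -> F \subset T -> zbasis (coboundaries_off F) beta -> injective s ->
  [set s i | i : 'I_k]%SET = (T :\: F) :&: Eplus o ->
  wedge beta *~ \det (\matrix_(i, j) value (s j) (beta i)) =
  ext_map (B_proj T) (wedge (fun j => dual_edge (s j))).
Proof.
move=> Fsub FT betaP sI sP; set M := \matrix_(i, j) _.
have [betaF _ _] := betaP.
have -> : wedge beta =
    wedge (fun j => B_proj T (dual_edge (s j))) *~ \det M.
  rewrite -wedge_det; congr wedge; apply/funext => i.
  rewrite {1}(coboundary_off_sum _ _ _ Fsub sI sP _ (betaF i)).
  by apply: eq_bigr => j _; rewrite mxE.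
rewrite ext_map_B_proj -mulrzA.
have [C [CM _]] := value_matrix_inv _ _ _ _ _ Fsub FT betaP sI sP.
have : \det M \is a GRing.unit.
  by apply/unitrPr; exists (\det C); rewrite mulrC -det_mulmx CM det1.
(* A unit of the integers is 1 or -1, so the two factors [\det M] multiply to 1. *)
by rewrite qualifE /= => /orP[] /eqP ->; rewrite mulr1z.
Qed.

End Projection.

(** * Nonzero minors and spanning trees *)

Lemma det_col0 (R : comNzRingType) n (A : 'M[R]_n) j :
  (forall i, A i j = 0) -> \det A = 0.
Proof.
by move=> A0; rewrite (expand_det_col _ j) big1 // => i _; rewrite A0 mul0r.
Qed.

Section Minors.
Context {G : graph} (o : orientation G).
Local Notation E := (edge G).
Implicit Types (A F T : {set E}) (e : E).

(** For a subgraph [F], this is the least subgraph containing [F] and [A]; it recovers a tree from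
    its edges in [E^+] outside [F]. *)
Definition sym_closure F A := F :|: A :|: [set e | einv e \in A].

Lemma subgraph_sym_closure F A : subgraph F -> subgraph (sym_closure F A).
Proof.
move=> Fsub; apply/forall_inP => e; rewrite !inE (subgraph_inv F) // einvK.
by case/orP => [/orP[]|] -> ; rewrite ?orbT.
Qed.

Context {F : {set E}} {k : nat} {beta : 'I_k -> cochains G} {s : 'I_k -> E}.
Hypotheses (connG : connected G) (Fsub : subgraph F) (Fac : acyclic F).
Hypothesis betaP : zbasis (coboundaries_off F) beta.
Hypotheses (sI : injective s) (sE : forall j, s j \in Eplus o).
Hypothesis det_neq0 : \det (\matrix_(i, j) value (s j) (beta i)) != 0.

Let T := sym_closure F [set s j | j : 'I_k].
Let Tsub : subgraph T := subgraph_sym_closure _ _ Fsub.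

Lemma mem_sym_closure_im j : s j \in T.
Proof. by rewrite !inE imset_f ?orbT. Qed.

Lemma sub_sym_closure : F \subset T.
Proof. by apply/fintype.subsetP => e eF; rewrite !inE eF. Qed.

(** If [T] does not connect [u] to [w], the cut around the component of [u] vanishes on [F] and at
    every [s j]; its coordinates in [beta] are then a relation between the rows. *)
Lemma ncomp_minor : ncomp T = 1%N.
Proof.
have Gsub : subgraph [set: E] by apply/forall_inP => e; rewrite !inE.
have [[v0] Gconn] := (ncomp1P _ Gsub).1 connG.
apply/(ncomp1P _ Tsub); split=> // u w; apply: contraNT det_neq0 => nuw.
pose x := delta (component_ind T u).
have xF : coboundaries_off F x.
  apply/(coboundaries_offP o _ _ Fsub); split; first by exists (component_ind T u).
  by move=> e /(fintype.subsetP sub_sym_closure)/value_component_ind-> .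
have [_ beta_gen _] := betaP; have [c xc] := beta_gen _ xF.
apply/det0P; exists (\row_i c i).
  apply: contraNneq nuw => /rowP c0.
  (* Were all coordinates 0, the indicator would be constant on the connected graph [G], although it
     separates [u] from [w]. *)
  have x0 e : e \in [set: E] -> value e x = 0.
    by rewrite xc big1 ?raddf0 // => i _; have := c0 i; rewrite !mxE => ->.
  have := connect_const _ _ _ _ x0 (Gconn u w).
  by rewrite /component_ind connect0; case: (connect _ u w).
apply/rowP => j; rewrite !mxE.
rewrite -[RHS](value_component_ind _ u _ Tsub (mem_sym_closure_im j)) -/x xc.
rewrite raddf_sum; apply: eq_bigr => i _.
by rewrite !mxE raddfMz /= -mulrzr intz mulrC.
Qed.

(* Since F is acyclic, a simple cycle of T runs through some s j; summing
   coboundaries along it yields a relation between the columns. *)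
Lemma acyclic_minor : acyclic T.
Proof.
apply/asboolP => c; apply: contraNN det_neq0 => cT.
(* The signed number of passages of the cycle through [e]. *)
pose n e := \sum_(a <- c) value a (dual_edge e).
have cycT a : a \in c -> a \in T.
  by case/and4P: cT => _ /allP cT _ _ /cT.
have [e ec eF] : exists2 e, e \in c & e \notin F.
  apply/hasP; apply: contraLR cT; rewrite has_predC negbK => cF.
  have := asboolP _ Fac c; apply: contra.
  by case/and4P => *; apply/and4P; split.
have [j ej] : exists j, (e == s j) || (e == einv (s j)).
  have := cycT e ec; rewrite !inE (negbTE eF) /= => /orP[] /imsetP[j _ ej].
    by exists j; rewrite ej eqxx.
  by exists j; rewrite -ej einvK eqxx orbT.
rewrite -det_tr; apply/det0P; exists (\row_j n (s j)).
  (* The entry at [j] is 1 or -1, since the cycle passes once through [e] and never through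
     [einv e]. *)
  apply/eqP => /rowP/(_ j); rewrite !mxE /n.
  rewrite (bigD1_seq e) ?(simple_cycle_uniq _ _ cT) //= big_seq_cond big1.
    move/eqP; rewrite addr0; apply/negP; case/orP: ej => /eqP->.
      by rewrite value_dual_diag.
    by rewrite value_inv value_dual_diag.
  move=> a /andP[ac ae]; have eic := simple_cycle_inv _ _ _ cT ec.
  have aie : a != einv e by apply: contraNneq eic => <-.
  by case/orP: ej => /eqP ej; apply: value_dual0;
    [rewrite -ej | rewrite -ej | rewrite -(einvK (s j)) -ej | rewrite -ej].
apply/rowP => i; rewrite !mxE.
have [betaF _ _] := betaP.
have [bB bF] := (coboundaries_offP o _ _ Fsub).1 (betaF i).
rewrite -[RHS](simple_cycle_sum _ _ _ cT bB).
(* Expand [beta i] in the dual basis and exchange the sums. Edges of [E^+] other than the [s j]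
   contribute 0: on [F] the cochain vanishes, and the cycle avoids those outside [T]. *)
under [RHS]eq_bigr => a _ do rewrite {1}(cochain_sum o (beta i)) raddf_sum.
rewrite exchange_big /= (bigID (mem [set s j | j : 'I_k]%SET)) /=.
rewrite [X in _ + X]big1 ?addr0 => [|a /andP[aE as_]].
  rewrite (eq_bigl (mem [set s j | j : 'I_k]%SET)) => [|a]; last first.
    by rewrite andb_idl // => /imsetP[l _ ->].
  rewrite big_imset /=; last by move=> ? ? _ _; apply: sI.
  apply: eq_bigr => l _; rewrite !mxE mulr_suml; apply: eq_bigr => a _.
  by rewrite raddfMz /= -mulrzr intz.
rewrite big_seq big1 // => b /cycT bT; rewrite raddfMz /=.
have [aF|aF] := boolP (a \in F); first by rewrite bF // mulr0z.
have aT : a \notin T.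
  rewrite !inE (negbTE aF) (negbTE as_) /=; apply/imsetP => -[l _ al].
  by have := sE l; rewrite -al Eplus_inv aE.
rewrite value_dual0 ?mul0rz //; first by apply: contraNneq aT => <-.
by apply: contraNneq aT => ba; rewrite -(subgraph_inv _ _ Tsub) -ba.
Qed.

Lemma spanning_tree_minor : T \in spanning_trees G.
Proof. by rewrite inE Tsub acyclic_minor ncomp_minor eqxx. Qed.

Lemma disjoint_minor j : s j \notin F.
Proof.
apply: contraNN det_neq0 => sF; rewrite (det_col0 _ _ _ j) // => i.
have [betaF _ _] := betaP.
have [_ bF] := (coboundaries_offP o _ _ Fsub).1 (betaF i).
by rewrite mxE bF.
Qed.

End Minors.

(** * Passage from the sum over edge sets to the sum over spanning trees *)

Theorem proposition3p4 (G : graph) (o : orientation G) (k : nat)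
    (F : {set edge G}) (beta : 'I_k -> cochains G)
    (connG : connected G)
    (hF : F \in forests G k)
    (hbeta : zbasis (coboundaries_off F) beta) :
  tens (wedge beta) (wedge beta) =
  \sum_(T in spanning_trees G | F \subset T)
     tens (ext_map (B_proj T) (dual_wedge o k (T :\: F)))
          (dual_wedge o k (T :\: F)).
Proof.
move: (hF); rewrite inE => /and3P[Fsub Fac _].
pose t (A : {set edge G}) := sort (edge_le o) (enum A).
have tA A : t A =i A by move=> e; rewrite mem_sort mem_enum.
have tU A : uniq (t A) by rewrite sort_uniq enum_uniq.
(* Extension by 0 off [E^+] lets the expansion run over all edges while using only the basis dual to
   [E^+]; minors of sets not inside [E^+] then have a zero column. *)
pose a i e := if e \in Eplus o then value e (beta i) else 0.
pose W (A : {set edge G}) := wedge_seq k [seq dual_edge e | e <- t A].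
pose m A := \det (\matrix_(i < k, j < k) [seq a i e | e <- t A]`_j).
have tsP A : size (t A) = k -> exists s : 'I_k -> edge G,
    [/\ injective s, [set s i | i : 'I_k]%SET = A,
        W A = wedge (fun j => dual_edge (s j)) &
        m A = \det (\matrix_(i, j) a i (s j))].
  move/eqP => tk; exists (tnth (Tuple tk)); split.
  - exact/tuple_uniqP/tU.
  - apply/setP => x; rewrite -[RHS]tA.
    by apply/imsetP/(tnthP (Tuple tk)) => [[i _ ->]|[i ->]]; exists i.
  - rewrite /W /wedge_seq size_map tk; congr wedge; apply/funext => i /=.
    by rewrite -(tnth_map (@dual_edge G) (Tuple tk)) (tnth_nth 0).
  - congr (\det _); apply/matrixP => i j; rewrite !mxE.
    by rewrite -(tnth_map (a i) (Tuple tk)) (tnth_nth 0).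
have wE : wedge beta = \sum_A W A *~ m A.
  rewrite -wedge_expand_sets //; congr wedge; apply/funext => i.
  rewrite [LHS](cochain_sum o) big_mkcond; apply: eq_bigr => e _.
  by rewrite /a; case: ifP; rewrite ?mulr0z.
(* The sets whose minor may be nonzero; each is the part in [E^+] of the complement of [F] in a
   spanning tree containing [F]. *)
pose P (A : {set edge G}) := [&& A \subset Eplus o, [disjoint A & F] &
  sym_closure F A \in spanning_trees G].
have -> : tens (wedge beta) (wedge beta) =
    \sum_(A | P A) tens (wedge beta) (W A *~ m A).
  rewrite {2}wE (raddf_sum (tens (wedge beta))).
  apply/esym/big_rmcond => A nPA.
  have [tk|tk] := eqVneq (size (t A)) k; last first.
    by rewrite /W /wedge_seq size_map (negbTE tk) mul0rz raddf0.
  have [s [sI sA _ mE]] := tsP A tk.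
  have [->|m0] := eqVneq (m A) 0; first by rewrite mulr0z raddf0.
  case/negP: nPA.
  have sE j : s j \in Eplus o.
    apply: contraNT m0 => sE; rewrite mE (det_col0 _ _ _ j) // => i.
    by rewrite mxE /a (negbTE sE).
  have dn : \det (\matrix_(i, j) value (s j) (beta i)) != 0.
    rewrite mE in m0; congr (\det _ != 0): m0; apply/matrixP => i j.
    by rewrite !mxE /a sE.
  rewrite -sA; apply/and3P; split.
  - by apply/fintype.subsetP => _ /imsetP[j _ ->].
  - rewrite disjoint_subset; apply/fintype.subsetP => _ /imsetP[j _ ->].
    exact: (disjoint_minor o Fsub hbeta dn).
  - exact: (spanning_tree_minor o connG Fsub Fac hbeta).
(* On these index sets [h] and [sym_closure F] are mutually inverse: the inverses added to [A] lie
   outside [E^+], and a subgraph is determined by its edges in [E^+]. *)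
pose h (T : {set edge G}) := (T :\: F) :&: Eplus o.
rewrite (reindex_onto h (sym_closure F)); last first.
  move=> A /and3P[/fintype.subsetP AE /pred0P AF _]; apply/setP => e; rewrite !inE.
  have := AF e; rewrite /=; have [/AE->|nA] /= := boolP (e \in A).
    by move->; rewrite orbT.
  rewrite orbF => _; case: (e \in F) => //=; apply/andP => -[/AE].
  by move=> eE; apply/negP; rewrite -(Eplus_inv o).
apply: eq_big => T.
  apply/andP/andP => [[/and3P[_ _ hT] /eqP TE]|[Ttree FT]].
    rewrite -TE; split=> //; apply/fintype.subsetP => e eF.
    by rewrite !inE eF.
  have Tsub : subgraph T by move: Ttree; rewrite inE => /andP[].
  have TE : sym_closure F (h T) = T.
    apply/setP => e; rewrite !inE (subgraph_inv F) // (subgraph_inv T) // Eplus_inv.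
    have [/(fintype.subsetP FT)-> //|_] /= := boolP (e \in F).
    by case: (e \in Eplus o); rewrite ?andbT ?andbF ?orbF.
  rewrite TE eqxx; split=> //; rewrite /P TE Ttree andbT; apply/andP; split.
    exact: subsetIr.
  by apply/pred0P => e; rewrite !inE; case: (e \in F) => //; rewrite andbF.
case/andP => /and3P[_ _ +] /eqP TE; rewrite TE => Ttree.
have FT : F \subset T.
  by rewrite -TE; apply/fintype.subsetP => e eF; rewrite !inE eF.
(* This size guarantees that [dual_wedge] is a true wedge product and not the default 0. *)
have tk : size (t (h T)) = k.
  apply: (card_complement_forest o Ttree F _ _ beta (tnth (in_tuple (t (h T))))) => //.
    exact/tuple_uniqP/tU.
  apply/setP => x; rewrite -[RHS]tA.
  by apply/imsetP/(tnthP (in_tuple _)) => [[i _ ->]|[i ->]]; exists i.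
have [s [sI sA WE mE]] := tsP _ tk.
(* Moving the minor to the left factor turns it into the image of the wedge under [B_proj T]. *)
rewrite -tens_mulzl -[dual_wedge o k _]/(W (h T)); congr (tens _ _).
rewrite WE -(wedge_basis_tree o Ttree Fsub FT hbeta sI sA) mE.
congr (_ *~ \det _); apply/matrixP => i j; rewrite !mxE /a.
suff -> : s j \in Eplus o by [].
have : s j \in h T by rewrite -sA imset_f.
by rewrite inE => /andP[].
Qed.
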